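(* Let $f\colon [0,1]\to\mathbb{R}$ be a nonlinear differentiable function. Then the union of the tangent lines of the graph of $f$ contains an open disk; that is, the interior of the subset $$\bigcup_{a\in[0,1]}\{(a+t,\ f(a)+f'(a)t) : t\in\mathbb{R}\}$$ of $\mathbb{R}^2$ is nonempty.
   Context: A function $f\colon[0,1]\to\mathbb{R}$ is called linear if there are constants $k,c\in\mathbb{R}$ with $f(x)=kx+c$ for all $x\in[0,1]$; nonlinear means not linear in this (affine) sense. Differentiability at the endpoints $0$ and $1$ is one-sided; $f'$ is not assumed continuous. *)

(* Defs.v *)
From HB Require Import structures.
From mathcomp Require Import all_boot all_order all_algebra.
From mathcomp Require Import all_classical all_reals all_analysis.

Set Implicit Arguments.
Unset Strict Implicit.
Unset Printing Implicit Defensive.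

Import Order.TTheory GRing.Theory Num.Theory.
Import numFieldNormedType.Exports.

Local Open Scope classical_set_scope.
Local Open Scope ring_scope.

(* A function [0,1] -> R is represented by f : R -> R of which only the values
   on `[0, 1] are ever used; in particular the difference quotient at a is
   taken along x in A with x <> a, so that for A = `[0, 1] the derivatives at 0
   and 1 are one-sided. *)
Definition differentiable_at_in (R : realType) (A : set R) (f : R -> R)
    (a : R) : Prop :=
  cvg ((f x - f a) / (x - a) @[x --> within A a^']).

Definition derivative_in (R : realType) (A : set R) (f : R -> R) (a : R) : R :=
  lim ((f x - f a) / (x - a) @[x --> within A a^']).

Definition differentiable_in (R : realType) (A : set R) (f : R -> R) : Prop :=
  forall a, A a -> differentiable_at_in A f a.

Definition linear_in (R : realType) (A : set R) (f : R -> R) : Prop :=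
  exists k c : R, forall x, A x -> f x = k * x + c.

Definition tangent_line (R : realType) (A : set R) (f : R -> R) (a : R)
    : set (R * R) :=
  [set (a + t, f a + derivative_in A f a * t) | t in [set: R]].

(* Main.v *)
Require Import Defs.
From HB Require Import structures.
From mathcomp Require Import all_boot all_order all_algebra.
From mathcomp Require Import all_classical all_reals all_analysis.
From mathcomp Require Import ring lra.

Set Implicit Arguments.
Unset Strict Implicit.

Import Order.TTheory GRing.Theory Num.Theory.
Import numFieldNormedType.Exports.

Local Open Scope classical_set_scope.
Local Open Scope ring_scope.

(** Fix x outside a closed interval A.  The tangent at a meets the vertical line
    through x at height g_x(a) = f(a) + f'(a) (x - a), and for a given y

      d/da [(f(a) - y) / (x - a)] = (g_x(a) - y) / (x - a)^2

    ([has_derivative_in_slope]): the point (x, y) lies on the tangent at a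
    exactly when the slope from (x, y) to the graph is critical at a.  The slope
    is differentiable on all of A because x is not in A, and derivatives have
    the intermediate value property even when discontinuous ([darboux]).  So if
    g_x(a) < y < g_x(b) for some a, b in A, then (x, y) is on some tangent
    ([tangent_cover]).  For fixed a and b these strict inequalities, and the
    condition that x is off A, are open in (x, y); hence a disk is covered as
    soon as g_x is nonconstant for a single x off A ([interior_tangents]).

    If instead g_x is constant for two different values of x, then all tangents
    agree at two abscissae, so they are one and the same line, which contains
    the graph ([linear_of_tangent_height_const]). *)

(** * Relative derivatives *)

Definition has_derivative_in (R : realType) (A : set R) (f : R -> R)
    (a l : R) : Prop :=
  (f x - f a) / (x - a) @[x --> within A a^'] --> l.

Lemma differentiable_in_derivative (R : realType) (A : set R) (f : R -> R)
    (a : R) :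
  differentiable_in A f -> A a -> has_derivative_in A f a (derivative_in A f a).
Proof. by move=> fd Aa; exact: fd. Qed.

Lemma has_derivative_inN (R : realType) (A : set R) (f : R -> R) (a l : R) :
  has_derivative_in A f a l -> has_derivative_in A (fun x => - f x) a (- l).
Proof.
move=> fl; rewrite /has_derivative_in.
under eq_fun do rewrite -opprD mulNr.
exact: cvgN.
Qed.

Lemma has_derivative_in_subset (R : realType) (A B : set R) (f : R -> R)
    (a l : R) : A `<=` B ->
  has_derivative_in B f a l -> has_derivative_in A f a l.
Proof.
by move=> AB; apply: cvg_trans; apply: cvg_app; exact: within_subset.
Qed.

Lemma cvg_within_dnbhs_id (R : realType) (A : set R) (a : R) :
  z @[z --> within A a^'] --> a.
Proof. by apply: cvg_within_filter; exact: nbhs_dnbhs. Qed.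

Lemma has_derivative_in_continuous (R : realType) (A : set R) (f : R -> R)
    (a l : R) :
  has_derivative_in A f a l -> f x @[x --> within A (nbhs a)] --> f a.
Proof.
move=> fl.
have fdl : f a + (f x - f a) / (x - a) * (x - a) @[x --> within A a^']
    --> f a + l * (a - a).
  apply: cvgD; first exact: cvg_cst.
  apply: cvgM; first exact: fl.
  apply: cvgB; last exact: cvg_cst.
  exact: cvg_within_dnbhs_id.
rewrite subrr mulr0 addr0 in fdl; move=> U fU.
have H : \forall x \near a, x != a -> A x ->
    U (f a + (f x - f a) / (x - a) * (x - a)) := fdl U fU.
apply: filterS H => x H Ax /=.
have [->|xa] := eqVneq x a; first exact: nbhs_singleton fU.
by have := H xa Ax; rewrite divfK ?subr_eq0// addrC subrK.
Qed.

(** * The intermediate value property of derivatives *)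

(** Taking the direction b - c with a sign treats descent to the right and to
    the left of c at once.  This covers endpoints of A too, where only one
    direction is available. *)
Lemma exists_lt_of_derivative (R : realType) (A : set R) (f : R -> R)
    (c b l : R) : is_interval A -> A c -> A b -> has_derivative_in A f c l ->
  (b - c) * l < 0 -> exists2 z, A z & f z < f c.
Proof.
move=> Aitv Ac Ab fl bcl.
have H : \forall z \near c, z != c -> A z ->
    (b - c) * ((f z - f c) / (z - c)) < 0.
  have bfl : (b - c) * ((f z - f c) / (z - c))
      @[z --> within A c^'] --> (b - c) * l.
    by apply: cvgM; [exact: cvg_cst|exact: fl].
  exact: cvgr_lt _ bfl _ bcl.
(* Approach c along the segment from c to b, which stays in A. *)
have cvgz : c + t * (b - c) @[t --> 0^'+] --> c + 0 * (b - c).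
  apply: cvgD; first exact: cvg_cst.
  apply: cvgM; last exact: cvg_cst.
  by apply: cvg_within_filter; exact: cvg_id.
rewrite mul0r addr0 in cvgz.
have /filter_ex[t [] [] t0 t1] : \forall t \near (0 : R)^'+, (0 < t /\ t < 1) /\
    (c + t * (b - c) != c -> A (c + t * (b - c)) ->
    (b - c) * ((f (c + t * (b - c)) - f c) / (c + t * (b - c) - c)) < 0).
  near=> t; split.
    by split; near: t; [exact: nbhs_right_gt|exact: nbhs_right_lt].
  by near: t; exact: (cvgz _ H).
have bc0 : b - c != 0 by apply: contraTneq bcl => ->; rewrite mul0r ltxx.
have tbc : t * (b - c) != 0 by rewrite mulf_neq0// gt_eqF.
have Az : A (c + t * (b - c)).
  have [cb|bc] := leP c b; [apply: (Aitv c b)|apply: (Aitv b c)] => //;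
    by apply/andP; split; nra.
rewrite -subr_eq0 [c + _]addrC addrK => /(_ tbc).
rewrite [_ + c]addrC => /(_ Az).
have -> (u : R) : (b - c) * (u / (t * (b - c))) = u / t.
  by field; rewrite bc0 gt_eqF.
rewrite pmulr_llt0 ?invr_gt0// subr_lt0 => ?.
by exists (c + t * (b - c)).
Unshelve. all: by end_near. Qed.

(** The minimum c of h on [a, b] is a critical point: there is no descent from
    c towards a nor towards b, and the signs of L a and L b provide descent into
    the interval from its ends, which rules out c = a and c = b. *)
Lemma darboux_lt (R : realType) (A : set R) (h L : R -> R) (a b : R) :
  is_interval A -> A a -> A b -> a < b ->
  (forall c, A c -> has_derivative_in A h c (L c)) ->
  L a < 0 -> 0 < L b -> exists2 c, A c & L c = 0.
Proof.
move=> Aitv Aa Ab ab hL La Lb.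
have abA : `[a, b] `<=` A by move=> x /=; rewrite in_itv; exact: Aitv.
have hLab c : `[a, b]%classic c -> has_derivative_in `[a, b] h c (L c).
  by move=> abc; apply: (has_derivative_in_subset abA); apply: hL; exact: abA.
have hcont : {within `[a, b], continuous h}.
  by apply/subspace_continuousP => c /hLab; exact: has_derivative_in_continuous.
have [c cab cmin] := EVT_min (ltW ab) hcont.
have slope_ge0 d : `[a, b]%classic d -> 0 <= (d - c) * L c.
  move=> abd; rewrite leNgt; apply/negP => dcL.
  have [z abz] := exists_lt_of_derivative (@interval_is_interval R `[a, b])
    cab abd (hLab _ cab) dcL.
  by rewrite ltNge cmin.
have aab : `[a, b]%classic a by rewrite /= in_itv /= lexx ltW.
have bab : `[a, b]%classic b by rewrite /= in_itv /= lexx ltW.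
have ac : 0 <= (a - c) * L c := slope_ge0 a aab.
have bc : 0 <= (b - c) * L c := slope_ge0 b bab.
have ca : c != a by apply/eqP => ca; move: bc La; rewrite ca; nra.
have cb : c != b by apply/eqP => cb; move: ac Lb; rewrite cb; nra.
exists c; first exact: abA.
move: cab; rewrite in_itv /= !le_eqVlt [a == c]eq_sym (negbTE ca) (negbTE cb) /=.
move=> /andP[ltac ltcb].
apply/eqP; rewrite eq_le; apply/andP; split; nra.
Qed.

(** Negating h exchanges the two signs, hence the roles of a and b, and reduces
    the case b < a to the case a < b. *)
Lemma darboux (R : realType) (A : set R) (h L : R -> R) (a b : R) :
  is_interval A -> A a -> A b ->
  (forall c, A c -> has_derivative_in A h c (L c)) ->
  L a < 0 -> 0 < L b -> exists2 c, A c & L c = 0.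
Proof.
move=> Aitv Aa Ab hL La Lb; have [ab|ba|ab] := ltgtP a b.
- exact: (darboux_lt Aitv Aa Ab ab hL).
- have [||c Ac /eqP] := darboux_lt (L := fun x => - L x) Aitv Ab Aa ba
    (fun c Ac => has_derivative_inN (hL c Ac)).
  + by rewrite oppr_lt0.
  + by rewrite oppr_gt0.
  + by rewrite oppr_eq0 => /eqP; exists c.
- by move: La; rewrite ab ltNge (ltW Lb).
Qed.

(** * Tangent lines through a point off the interval *)

Definition tangent_height (R : realType) (A : set R) (f : R -> R)
    (x a : R) : R :=
  f a + derivative_in A f a * (x - a).

Lemma tangent_lineP (R : realType) (A : set R) (f : R -> R) (x y a : R) :
  tangent_line A f a (x, y) <-> y = tangent_height A f x a.
Proof.
rewrite /tangent_line /tangent_height; split=> [[t _ [<- <-]]|->].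
  by rewrite [a + t]addrC addrK.
by exists (x - a) => //; rewrite addrC subrK.
Qed.

(** This is the quotient rule for the slope from (x, y) to the graph, and its
    numerator is the height over y at which the tangent at a passes; so the
    slope is critical at a exactly when that tangent contains (x, y). *)
Lemma has_derivative_in_slope (R : realType) (A : set R) (f : R -> R)
    (x y a l : R) : x != a -> has_derivative_in A f a l ->
  has_derivative_in A (fun z => (f z - y) / (x - z)) a
    ((f a + l * (x - a) - y) / (x - a) ^+ 2).
Proof.
move=> xa fl.
have idA := @cvg_within_dnbhs_id R A a.
(* For z near a, this is the difference quotient of the slope, rewritten in
   terms of the one of f. *)
have : (f a + (f z - f a) / (z - a) * (x - a) - y) / ((x - z) * (x - a))
   @[z --> within A a^'] --> (f a + l * (x - a) - y) / (x - a) ^+ 2.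
  rewrite expr2; apply: cvgM; last first.
    apply: cvgV; first by rewrite mulf_neq0// subr_eq0.
    apply: cvgM; last exact: cvg_cst.
    by apply: cvgB idA; exact: cvg_cst.
  apply: cvgB; last exact: cvg_cst.
  apply: cvgD; first exact: cvg_cst.
  apply: cvgM; last exact: cvg_cst.
  exact: fl.
apply: cvg_trans; apply: near_eq_cvg.
have xz : \forall z \near a, z != x.
  by apply: open_nbhs_nbhs; split; [exact: open_neq|rewrite eq_sym].
apply: filterS xz => z zx za Az /=.
by field; rewrite !subr_eq0 za (eq_sym x z) zx xa.
Qed.

(** The derivative of the slope from (x, y) has the sign of the tangent height
    minus y, so it is negative at a and positive at b, and [darboux] applies. *)
Lemma tangent_cover (R : realType) (A : set R) (f : R -> R) (x y a b : R) :
  is_interval A -> differentiable_in A f -> ~ A x -> A a -> A b ->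
  tangent_height A f x a < y -> y < tangent_height A f x b ->
  (\bigcup_(c in A) tangent_line A f c) (x, y).
Proof.
move=> Aitv fd Ax Aa Ab ay yb.
have neqx c : A c -> x != c by move=> Ac; apply/eqP => xc; apply: Ax; rewrite xc.
have sq_gt0 c : A c -> 0 < ((x - c) ^+ 2)^-1.
  by move=> Ac; rewrite invr_gt0 exprn_even_gt0//= subr_eq0 neqx.
have [|||c Ac] := @darboux R A (fun z => (f z - y) / (x - z))
  (fun c => (tangent_height A f x c - y) / (x - c) ^+ 2) a b Aitv Aa Ab.
- move=> c Ac; apply: has_derivative_in_slope; first exact: neqx.
  exact: differentiable_in_derivative.
- by rewrite pmulr_llt0 ?sq_gt0// subr_lt0.
- by rewrite pmulr_lgt0 ?sq_gt0// subr_gt0.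
move=> /eqP; rewrite mulf_eq0 (gt_eqF (sq_gt0 _ Ac)) orbF subr_eq0 => /eqP cy.
by exists c => //; apply/tangent_lineP.
Qed.

Lemma continuous_tangent_height (R : realType) (A : set R) (f : R -> R)
    (a : R) :
  continuous (fun q : R * R => q.2 - tangent_height A f q.1 a).
Proof.
move=> p; apply: cvgB; first exact: cvg_snd.
apply: cvgD; first exact: cvg_cst.
apply: cvgM; first exact: cvg_cst.
by apply: cvgB; [exact: cvg_fst|exact: cvg_cst].
Qed.

(** * A disk of tangent points *)

Lemma interior_tangents (R : realType) (A : set R) (f : R -> R) (x a b : R) :
  is_interval A -> closed A -> differentiable_in A f -> ~ A x -> A a -> A b ->
  tangent_height A f x a < tangent_height A f x b ->
  interior (\bigcup_(c in A) tangent_line A f c) !=set0.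
Proof.
move=> Aitv Acl fd Ax Aa Ab xab.
pose y := (tangent_height A f x a + tangent_height A f x b) / 2.
exists (x, y); rewrite /interior /=.
have nA : \forall q \near (x, y), ~ A q.1.
  have fstxy : q.1 @[q --> nbhs (x, y)] --> x by exact: cvg_fst.
  apply: (fstxy (~` A)).
  by apply: open_nbhs_nbhs; split=> //; exact: closed_openC.
have na : \forall q \near (x, y), 0 < q.2 - tangent_height A f q.1 a.
  apply: (cvgr_gt _ (@continuous_tangent_height _ _ _ _ (x, y))).
  by rewrite /y /=; lra.
have nb : \forall q \near (x, y), q.2 - tangent_height A f q.1 b < 0.
  apply: (cvgr_lt _ (@continuous_tangent_height _ _ _ _ (x, y))).
  by rewrite /y /=; lra.
near=> q; rewrite [q]surjective_pairing.
apply: (@tangent_cover R A f q.1 q.2 a b) => //.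
- by near: q.
- by rewrite -subr_gt0; near: q.
- by rewrite -subr_lt0; near: q.
Unshelve. all: by end_near. Qed.

(** Equal heights at x and x' force equal slopes, since x - x' != 0; equal
    intercepts follow, so that f lies on its own common tangent. *)
Lemma linear_of_tangent_height_const (R : realType) (A : set R)
    (f : R -> R) (x x' : R) :
  A !=set0 -> x != x' ->
  {in A &, forall a b, tangent_height A f x a = tangent_height A f x b} ->
  {in A &, forall a b, tangent_height A f x' a = tangent_height A f x' b} ->
  linear_in A f.
Proof.
move=> [a Aa] xx' Hx Hx'.
exists (derivative_in A f a), (f a - derivative_in A f a * a) => b Ab.
have := Hx a b; have := Hx' a b.
rewrite !inE /tangent_height => /(_ Aa Ab) e' /(_ Aa Ab) e.
have : derivative_in A f a = derivative_in A f b.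
  apply: (mulIf (x := x - x')); first by rewrite subr_eq0.
  lra.
by move=> ab; move: e; rewrite -ab; lra.
Qed.

Theorem corollary2p3 (R : realType) (f : R -> R)
    (f_nonlinear : ~ linear_in `[0, 1] f)
    (f_diff : differentiable_in `[0, 1] f) :
  interior (\bigcup_(a in `[0, 1]) tangent_line `[0, 1] f a) !=set0.
Proof.
apply: contrapT => no_interior; apply: f_nonlinear.
have heights x : 1 < x -> {in `[0, 1]%classic &, forall a b,
    tangent_height `[0, 1] f x a = tangent_height `[0, 1] f x b}.
  move=> x1 a b /set_mem Aa /set_mem Ab.
  have Ax : ~ `[0, 1]%classic x.
    by rewrite /= in_itv /= => /andP[_]; rewrite leNgt x1.
  have itv := @interval_is_interval R `[0, 1].
  have cl : closed `[(0 : R), 1]%classic by exact: itv_closed.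
  have [ltab|ltba|//] := ltgtP (tangent_height `[0, 1] f x a)
                              (tangent_height `[0, 1] f x b).
  - by exfalso; apply: no_interior; apply: interior_tangents ltab.
  - by exfalso; apply: no_interior; apply: interior_tangents ltba.
(* Any two abscissae to the right of 1 would do. *)
apply: (@linear_of_tangent_height_const R _ f 2 3).
- by exists 0; rewrite /= in_itv /= lexx ler01.
- by rewrite eqr_nat.
- by apply: heights; rewrite ltr1n.
- by apply: heights; rewrite ltr1n.
Qed.
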